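(* Let $X$ be a pointed metric space. On the space $\mathrm{Lip}_0(X)$, the bounded weak* topology $\tau_{bw^*}$ is the topology $\tau_\gamma$.
   Context: $\mathbb{K}$ is $\mathbb{R}$ or $\mathbb{C}$. $(X,d)$ is a metric space with a distinguished base point $0$. $\mathrm{Lip}_0(X)$ is the Banach space of all Lipschitz functions $f\colon X\to\mathbb{K}$ with $f(0)=0$, with norm $\mathrm{Lip}(f)=\sup\{|f(x)-f(y)|/d(x,y)\colon x,y\in X,\ x\ne y\}$ and closed unit ball $B_{\mathrm{Lip}_0(X)}$. $\mathcal{F}(X)$ is the norm-closed linear hull in the Banach dual $\mathrm{Lip}_0(X)'$ of the functionals $\delta_x\colon f\mapsto f(x)$, $x\in X$. $\mathrm{Lip}_0(X)$ is identified isometrically with the dual $\mathcal{F}(X)'$ via $f\mapsto T_f$, $T_f(\varphi)=\varphi(f)$; the weak* topology $\tau_{w^*}$ on $\mathrm{Lip}_0(X)$ is $\sigma(\mathrm{Lip}_0(X),\mathcal{F}(X))$. For a Banach space $E$, the bounded weak* topology $\tau_{bw^*}$ on $E'$ is the largest topology on $E'$ agreeing with the weak* topology on norm bounded sets; here it is taken on $\mathrm{Lip}_0(X)=\mathcal{F}(X)'$. $\tau_0$ is the compact-open topology on $\mathrm{Lip}_0(X)$ (uniform convergence on compact subsets of $X$). $\tau_\gamma$ is the mixed topology $\gamma[\mathrm{Lip},\tau_0]$ on $\mathrm{Lip}_0(X)$: the locally convex topology having as a base of neighborhoods of zero the sets $\gamma(U)=\bigcup_{n=1}^\infty\left(U_1\cap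 B_{\mathrm{Lip}_0(X)}+U_2\cap 2B_{\mathrm{Lip}_0(X)}+\cdots+U_n\cap 2^{n-1}B_{\mathrm{Lip}_0(X)}\right)$, where $U=\{U_n\}$ ranges over sequences of convex balanced $\tau_0$-neighborhoods of zero. *)

(* Defs.v *)
From HB Require Import structures.
From mathcomp Require Import all_boot all_order all_algebra.
From mathcomp Require Import complex.
From mathcomp Require Import all_classical all_reals all_analysis.

Set Implicit Arguments.
Unset Strict Implicit.
Unset Printing Implicit Defensive.

Import Order.TTheory GRing.Theory Num.Theory.
Import numFieldNormedType.Exports.

Local Open Scope classical_set_scope.
Local Open Scope ring_scope.

(* MathComp norms on a scalar field [K] take their values in [K]; the record
   adds the [R]-valued modulus, so that [K = R] and [K = R[i]] are treated
   uniformly. Only the two instances below occur in the final statement. *)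
Record scalarField (R : realType) := ScalarField {
  scalar_sort :> numFieldType ;
  of_real : {rmorphism R -> scalar_sort} ;
  modulus : scalar_sort -> R ;
  of_real_modulus : forall z, of_real (modulus z) = `|z| ;
  ler_of_real : {mono of_real : x y / x <= y} }.

Definition real_scalar (R : realType) : scalarField R :=
  @ScalarField R R idfun Num.norm (fun=> erefl) (fun _ _ => erefl).

Lemma of_real_normc (R : realType) (z : R[i]) :
  real_complex R (ComplexField.Normc.normc z) = `|z|.
Proof. by []. Qed.

Definition complex_scalar (R : realType) : scalarField R :=
  @ScalarField R R[i] (real_complex R) (@ComplexField.Normc.normc R)
    (@of_real_normc R) (@lecR R).

Section modulus_theory.
Context {R : realType} {K : scalarField R}.
Implicit Types z w : K.

Lemma of_real_inj : injective (of_real K).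
Proof. exact: fmorph_inj. Qed.

Lemma modulus_ge0 z : 0 <= modulus z.
Proof. by rewrite -(ler_of_real K) rmorph0 of_real_modulus. Qed.

Lemma modulus0 : modulus (0 : K) = 0.
Proof. by apply: of_real_inj; rewrite of_real_modulus rmorph0 normr0. Qed.

Lemma modulus_eq0 z : modulus z = 0 -> z = 0.
Proof.
by move=> z0; apply/normr0_eq0; rewrite -of_real_modulus z0 rmorph0.
Qed.

Lemma modulusM z w : modulus (z * w) = modulus z * modulus w.
Proof. by apply: of_real_inj; rewrite rmorphM !of_real_modulus normrM. Qed.

Lemma modulusD z w : modulus (z + w) <= modulus z + modulus w.
Proof. by rewrite -(ler_of_real K) rmorphD !of_real_modulus ler_normD. Qed.

End modulus_theory.

Section lip0.
Context {R : realType} (K : scalarField R) (X : metricType R) (x0 : X).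

Definition lip0_pred : {pred X -> K^o} := [pred f : X -> K^o | `[< f x0 = 0 /\
  exists k : R, forall x y, modulus (f x - f y) <= k * mdist x y >]].

Lemma lip0_submod_closed : submod_closed lip0_pred.
Proof.
split; first apply/asboolP; first split=> //.
  by exists 0 => x y; rewrite subrr modulus0 mul0r.
move=> a f g /asboolP[f0 [kf fk]] /asboolP[g0 [kg gk]]; apply/asboolP; split.
  by change (a *: f x0 + g x0 = 0); rewrite f0 g0 scaler0 addr0.
exists (modulus a * kf + kg) => x y.
rewrite -[X in modulus X]/((a *: f x + g x) - (a *: f y + g y)).
rewrite opprD addrACA -scalerBr.
rewrite (le_trans (modulusD _ _))// mulrDl lerD// -mulrA modulusM.
by rewrite ler_wpM2l// modulus_ge0.
Qed.

HB.instance Definition _ := GRing.isSubmodClosed.Build _ _ lip0_pred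
  lip0_submod_closed.

Record lip0 := Lip0 { lip0_fun :> X -> K^o ; _ : lip0_fun \in lip0_pred }.

HB.instance Definition _ := [isSub for lip0_fun].
HB.instance Definition _ := [Choice of lip0 by <:].
HB.instance Definition _ := [SubChoice_isSubLmodule of lip0 by <:].

(* When [X] is a point this is [sup set0 = 0]. *)
Definition Lip (f : lip0) : R :=
  sup [set modulus (f p.1 - f p.2) / mdist p.1 p.2 | p in [set p | p.1 != p.2]].

Lemma lip0_base (f : lip0) : f x0 = 0.
Proof. by case: f => f /= /asboolP[]. Qed.

Lemma le_Lip (f : lip0) x y : modulus (f x - f y) <= Lip f * mdist x y.
Proof.
have [->|xy] := eqVneq x y; first by rewrite subrr modulus0 mdistxx mulr0.
rewrite -ler_pdivrMr ?mdist_gt0//; apply: ub_le_sup; last by exists (x, y).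
case: f => f /= /asboolP[_ [k fk]]; exists k => _ /= [[a b]] /= ab <-.
by rewrite ler_pdivrMr ?mdist_gt0.
Qed.

Lemma Lip_le (f : lip0) (k : R) : 0 <= k ->
  (forall x y, modulus (f x - f y) <= k * mdist x y) -> Lip f <= k.
Proof.
move=> k0 fk; rewrite /Lip; set S := (X in sup X).
have [->|S0] := eqVneq S set0; first by rewrite sup0.
apply: ge_sup; first exact/set0P.
by move=> _ [[x y]] /= xy <-; rewrite ler_pdivrMr ?mdist_gt0.
Qed.

Lemma Lip_ge0 (f : lip0) : 0 <= Lip f.
Proof.
rewrite /Lip; set S := (X in sup X).
have [->|/set0P[_ [[x y] /= xy _]]] := eqVneq S set0; first by rewrite sup0.
have := le_trans (modulus_ge0 _) (le_Lip f x y).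
by rewrite pmulr_lge0// mdist_gt0.
Qed.

Lemma LipD (f g : lip0) : Lip (f + g) <= Lip f + Lip g.
Proof.
apply: Lip_le => [|x y]; first by rewrite addr_ge0// Lip_ge0.
rewrite -[X in modulus X]/((f x + g x) - (f y + g y)) opprD addrACA.
by rewrite (le_trans (modulusD _ _))// mulrDl lerD// le_Lip.
Qed.

Let LipZ_le (a : K) (f : lip0) : Lip (a *: f) <= modulus a * Lip f.
Proof.
apply: Lip_le => [|x y]; first by rewrite mulr_ge0 ?modulus_ge0 ?Lip_ge0.
rewrite -[X in modulus X]/(a *: f x - a *: f y) -scalerBr modulusM -mulrA.
by rewrite ler_wpM2l ?modulus_ge0// le_Lip.
Qed.

Lemma LipZ (a : K) (f : lip0) : Lip (a *: f) = modulus a * Lip f.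
Proof.
apply/eqP; rewrite eq_le LipZ_le/=.
have [->|a0] := eqVneq a 0; first by rewrite modulus0 mul0r Lip_ge0.
have m0 : 0 < modulus a.
  rewrite lt_neqAle modulus_ge0 andbT eq_sym.
  by apply: contra_neq a0; exact: modulus_eq0.
rewrite -ler_pdivlMl// -{1}[f](scalerK a0) (le_trans (LipZ_le _ _))//.
rewrite (_ : modulus a^-1 = (modulus a)^-1)//; apply: (mulfI (lt0r_neq0 m0)).
rewrite -modulusM (divff a0) (divff (lt0r_neq0 m0)).
by apply: (@of_real_inj _ K); rewrite of_real_modulus normr1 rmorph1.
Qed.

Lemma Lip_eq0 (f : lip0) : Lip f = 0 -> f = 0.
Proof.
move=> f0; apply/val_inj/funext => x /=; apply/modulus_eq0/eqP.
rewrite eq_le modulus_ge0 andbT; have := le_Lip f x x0.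
by rewrite f0 mul0r lip0_base subr0.
Qed.

Let normD (f g : lip0) :
  of_real K (Lip (f + g)) <= of_real K (Lip f) + of_real K (Lip g).
Proof. by rewrite -rmorphD ler_of_real LipD. Qed.

Let normZ (a : K) (f : lip0) :
  of_real K (Lip (a *: f)) = `|a| * of_real K (Lip f).
Proof. by rewrite LipZ rmorphM of_real_modulus. Qed.

Let norm_eq0 (f : lip0) : of_real K (Lip f) = 0 -> f = 0.
Proof. by move/eqP; rewrite fmorph_eq0 => /eqP/Lip_eq0. Qed.

HB.instance Definition _ := @Lmodule_isNormed.Build K lip0
  (fun f => of_real K (Lip f)) normD normZ norm_eq0.

End lip0.

Section dual.
Context {R : realType} {K : scalarField R} {E : normedModType K}.

Definition dual_space : set (E -> K^o) := [set phi | linear phi /\ continuous phi].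

Definition dual_norm (phi : E -> K^o) : R :=
  sup [set modulus (phi f) | f in [set f | `|f| <= 1]].

Definition linear_hull (A : set (E -> K^o)) : set (E -> K^o) :=
  [set phi | exists n (a : 'I_n -> K) (g : 'I_n -> E -> K^o),
    (forall i, A (g i)) /\ phi = \sum_(i < n) a i *: g i].

Definition dual_closure (A : set (E -> K^o)) : set (E -> K^o) :=
  [set phi | dual_space phi /\ forall e : R, 0 < e ->
    exists2 psi, A psi & dual_norm (phi - psi) < e].

(* The topology $\sigma(E, F)$. *)
Definition initial_topology_of (F : set (E -> K^o)) : Topological E :=
  Topological.class (sup_topology (fun phi : {phi | F phi} =>
    Topological.class (initial_topology (sval phi)))).

Definition open_of (T : Topological E) : set_system E :=
  @open (Topological.Pack T).

(* Equality of the traces of the open sets, i.e. of the subspace topologies. *)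
Definition agree_on_bounded (S T : Topological E) := forall B : set E,
  bounded_set B ->
  [set A `&` B | A in open_of S] = [set A `&` B | A in open_of T].

Definition largest_agreeing_on_bounded (S T : Topological E) :=
  agree_on_bounded S T /\
  forall S', agree_on_bounded S' T -> open_of S' `<=` open_of S.

Definition balanced (U : set E) :=
  forall (a : K) u, `|a| <= 1 -> U u -> U (a *: u).

(* Indices start at 0: [U n] is $U_{n+1}$ and [2 ^+ n] is $2^{(n+1)-1}$. *)
Definition mixed_set (U : nat -> set E) : set E :=
  [set f | exists n (h : nat -> E),
    (forall i, (i <= n)%N -> U i (h i) /\ `|h i| <= 2 ^+ i) /\
    f = \sum_(i < n.+1) h i].

End dual.

Lemma compact_open_comp_continuous (T U : topologicalType) (m : U -> U) :
  continuous m ->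
  continuous ((fun g => m \o g) : {compact-open, T -> U} -> {compact-open, T -> U}).
Proof.
move=> cm g.
apply: (iffRL (compact_open_cvgP _ _)) => [|C O cC oO gCO].
  by apply: fmap_filter; exact: (@nbhs_filter {compact-open, T -> U} g).
have : open (m @^-1` O) by apply: open_comp oO => z _; exact: cm.
move=> /(compact_open_open cC) oCO2.
have : nbhs (g : {compact-open, T -> U}) [set g | g @` C `<=` m @^-1` O].
  apply: open_nbhs_nbhs; split => // _ [x Cx <-]; apply: gCO.
  by exists x.
apply: filterS => g' g'C _ [x Cx <-]; apply: g'C.
by exists x.
Qed.

Section lip0_topologies.
Context {R : realType} (K : scalarField R) (X : metricType R) (x0 : X).
Local Notation E := (lip0 K x0).

Definition delta (x : X) : E -> K^o := fun f => f x.

Definition lipschitz_free : set (E -> K^o) :=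
  dual_closure (linear_hull (range delta)).

(* [lip0] is the dual of [lipschitz_free] through $f \mapsto (\phi \mapsto \phi(f))$;
   this is an isometry, so norm bounded sets of that dual are those of [lip0]. *)
Definition weak_star : Topological E := initial_topology_of lipschitz_free.

Definition is_bounded_weak_star (T : Topological E) :=
  largest_agreeing_on_bounded T weak_star.

Definition lip0_compact_open : Type :=
  initial_topology (fun f : E => (f : X -> K) : {compact-open, X -> K}).

HB.instance Definition _ := Topological.on lip0_compact_open.

Definition mixed_index : set (nat -> set E) :=
  [set U | forall n, [/\ convex_set (U n : set (convex_lmodType E)),
    balanced (U n) & nbhs ((0 : E) : lip0_compact_open) (U n)]].

(* A 0-neighborhood base of sets [mixed_set U] and its translates define the
   mixed topology. *)
Definition lip0_mixed : Type := E.

Definition mixed_nbhs (f : lip0_mixed) : set_system lip0_mixed :=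
  filter_from mixed_index (fun U => [set (f : E) + g | g in mixed_set U]).

Lemma mixed_index0 (U : nat -> set E) n : mixed_index U -> U n 0.
Proof. by move=> /(_ n)[_ _ /nbhs_singleton]. Qed.

Lemma mixed_index_shift (U : nat -> set E) : mixed_index U ->
  exists2 V, mixed_index V & forall n f g, V n f -> V n g -> U n.+1 (f + g).
Proof.
move=> mU; exists (fun n => [set f | U n.+1 (2 *: f)]); last first.
  move=> n f g Uf Ug; have [cU _ _] := mU n.+1.
  have h0 : 0 <= 2^-1 :> K by rewrite invr_ge0.
  have h1 : 2^-1 <= 1 :> K by rewrite invf_le1// ler1n.
  have h2 : 1 - 2^-1 = 2^-1 :> K.
    by apply/eqP; rewrite subr_eq [eqbLHS]splitr mul1r.
  pose h : {i01 K} := Itv01 h0 h1.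
  have /set_mem := cU _ _ h (mem_set Uf) (mem_set Ug).
  rewrite -[conv h _ _]/(2^-1 *: (2 *: f) + (1 - 2^-1) *: (2 *: g)).
  by rewrite h2 !scalerA mulVf ?pnatr_eq0// !scale1r.
move=> n; have [cU bU nU] := mU n.+1; split.
- move=> f g l /set_mem/= Uf /set_mem/= Ug; apply/mem_set => /=.
  have : U n.+1 (l%:num *: (2 *: f) + (1 - l%:num) *: (2 *: g)).
    exact: (set_mem (cU _ _ l (mem_set Uf) (mem_set Ug))).
  rewrite !scalerA ![_ * 2]mulrC -!scalerA -scalerDr.
  exact.
- by move=> a f a1 /= Uf; rewrite scalerA mulrC -scalerA; exact: bU.
- pose m (z : K) : K := 2 * z.
  have /continuousP cm : continuous ((fun g => m \o g) :
      {compact-open, X -> K} -> {compact-open, X -> K}).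
    by apply: compact_open_comp_continuous => z; exact: mulrl_continuous.
  move: nU; rewrite nbhsE => -[_ [[C oC <-] C0] CU].
  exists ((fun f : E => m \o f : {compact-open, X -> K}) @^-1` C).
    split; last by move: C0; rewrite /= -[in X in X -> _](scaler0 _ 2).
    by exists ((fun g : {compact-open, X -> K} => m \o g) @^-1` C);
      first exact: cm.
  by move=> f Cf; exact: CU.
Qed.

Lemma mixed_setP (U : nat -> set E) f : (forall n, U n 0) -> mixed_set U f ->
  exists n (h : nat -> E), (forall i, U i (h i) /\ `|h i| <= 2 ^+ i) /\
    forall m, (n <= m)%N -> f = \sum_(i < m.+1) h i.
Proof.
move=> U0 [n [h [hU ->]]].
exists n, (fun i => if (i <= n)%N then h i else 0); split=> [i|m nm].
  by case: ifPn => [/hU//|_]; rewrite normr0 exprn_ge0.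
by rewrite (big_ord_widen m.+1 h)// big_mkcond.
Qed.

Lemma mixed_setD (U V : nat -> set E) : mixed_index U -> mixed_index V ->
  (forall n f g, V n f -> V n g -> U n.+1 (f + g)) ->
  forall f g, mixed_set V f -> mixed_set V g -> mixed_set U (f + g).
Proof.
move=> mU mV VU f g.
have V0 n := @mixed_index0 V n mV; have U0 n := @mixed_index0 U n mU.
move=> /(mixed_setP V0)[n [h [hV fE]]] /(mixed_setP V0)[m [k [kV gE]]].
exists (maxn n m).+1, (fun i => if i is j.+1 then h j + k j else 0); split.
  move=> [|i] _; first by rewrite normr0.
  have [hi hn] := hV i; have [ki kn] := kV i; split; first exact: VU.
  by rewrite exprS mulr_natl mulr2n (le_trans (ler_normD _ _))// lerD.
rewrite (fE (maxn n m)) ?leq_maxl// (gE (maxn n m)) ?leq_maxr//.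
by rewrite [RHS]big_ord_recl/= add0r big_split.
Qed.

Lemma mixed_indexI (U V : nat -> set E) : mixed_index U -> mixed_index V ->
  mixed_index (fun n => U n `&` V n).
Proof.
move=> mU mV n; have [cU bU nU] := mU n; have [cV bV nV] := mV n.
split; last exact: filterI.
- move=> f g l /set_mem[Uf Vf] /set_mem[Ug Vg]; apply/mem_set; split.
    exact: (set_mem (cU _ _ l (mem_set Uf) (mem_set Ug))).
  exact: (set_mem (cV _ _ l (mem_set Vf) (mem_set Vg))).
- by move=> a f a1 [Uf Vf]; split; [exact: bU|exact: bV].
Qed.

Lemma mixed_indexT : mixed_index (fun=> [set: E]).
Proof. by move=> n; split=> [? ? ? _ _| |]; rewrite ?in_setT//; exact: filterT. Qed.

Lemma mixed_set0 (U : nat -> set E) : mixed_index U -> mixed_set U 0.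
Proof.
move=> mU; exists 0%N, (fun=> 0); split; last by rewrite big1.
by move=> i _; rewrite normr0 exprn_ge0//; split => //; exact: mixed_index0.
Qed.

Lemma sub_mixed_set (U V : nat -> set E) : (forall n, U n `<=` V n) ->
  mixed_set U `<=` mixed_set V.
Proof.
move=> UV f [n [h [hU ->]]]; exists n, h; split => // i /hU[Ui hi].
by split => //; exact: UV.
Qed.

Lemma mixed_nbhs_filter (f : lip0_mixed) : ProperFilter (mixed_nbhs f).
Proof.
apply: filter_from_proper; last first.
  move=> U mU; exists (f : E), 0; first exact: mixed_set0.
  by rewrite addr0.
apply: filter_from_filter; first by exists (fun=> setT); exact: mixed_indexT.
move=> U V mU mV; exists (fun n => U n `&` V n); first exact: mixed_indexI.
move=> _ [g UVg <-]; split; exists g => //; apply: sub_mixed_set UVg => n.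
  exact: subIsetl.
exact: subIsetr.
Qed.

Lemma mixed_nbhs_singleton (f : lip0_mixed) A : mixed_nbhs f A -> A f.
Proof.
move=> [U mU]; apply; exists 0; first exact: mixed_set0.
by rewrite addr0.
Qed.

Lemma mixed_nbhs_nbhs (f : lip0_mixed) A :
  mixed_nbhs f A -> mixed_nbhs f (fun g => mixed_nbhs g A).
Proof.
move=> [U mU UA]; have [V mV VU] := mixed_index_shift mU.
exists V => // _ [g Vg <-]; exists V => // _ [h Vh <-]; apply: UA.
by exists (g + h); [exact: (mixed_setD mU mV)|rewrite addrA].
Qed.

HB.instance Definition _ := Choice.on lip0_mixed.
HB.instance Definition _ := hasNbhs.Build lip0_mixed mixed_nbhs.
HB.instance Definition _ := Nbhs_isNbhsTopological.Build lip0_mixed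
  mixed_nbhs_filter mixed_nbhs_singleton mixed_nbhs_nbhs.

Definition mixed_topology : Topological E := Topological.class lip0_mixed.

End lip0_topologies.

(* Main.v *)
Require Import Defs.
From HB Require Import structures.
From mathcomp Require Import all_boot all_order all_algebra.
From mathcomp Require Import complex.
From mathcomp Require Import all_classical all_reals all_analysis.
From mathcomp Require Import ring lra.

(** The proof compares both topologies with the topology of pointwise
    convergence on the space [E] of Lipschitz functions vanishing at the base
    point.

    On a norm bounded set the weak* topology, the compact-open topology, the
    mixed topology and pointwise convergence all coincide. For the weak*
    topology, the free space is the norm closure of the span of the evaluations,
    and a norm approximation of a functional is uniform on bounded sets
    ([ptwise_agree_weak_star]). For the compact-open topology, a bounded set is
    equicontinuous, so pointwise convergence on it is uniform on compact sets
    ([compact_open_on_ball]); and a single summand of [mixed_set U] already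
    covers a bounded part of a neighborhood of zero, while globally the mixed
    topology refines pointwise convergence by a geometric series
    ([ptwise_agree_mixed]).

    The mixed topology is the largest such topology because of a construction
    in the manner of Banach and Dieudonne ([mixed_set_sub]). Closed balls are
    compact for pointwise convergence (Tychonoff, [ball_compact]). Let [V] be a
    set containing 0 whose trace on each ball is pointwise open in that ball.
    The sets [U n] are chosen one after the other, keeping the partial sum
    [S n] of the sets [U i `&` 2 ^ i B] for [i < n] compact and inside [V]: as
    [S n] is compact and [V] is relatively open in the ball of radius
    [2 ^ (n + 1)], which contains [S n + 2 ^ n B], some pointwise neighborhood
    [U n] of 0 satisfies [S n + (U n `&` 2 ^ n B) `<=` V] ([compact_step]). Then
    [mixed_set U `<=` V]; applied to the translates of an open set, this shows
    that the set is open in the mixed topology ([open_mixed]).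

    The scalar field enters only through the compactness of its closed
    discs, so the argument is carried out for any field with that property. *)

Set Implicit Arguments.
Unset Strict Implicit.
Unset Printing Implicit Defensive.

Import Order.TTheory GRing.Theory Num.Theory.
Import numFieldNormedType.Exports.

Local Open Scope classical_set_scope.
Local Open Scope ring_scope.

(** * Powers of two *)

Lemma le_exp2_ex (R : realType) (M : R) : exists n, M <= 2 ^+ n.
Proof.
exists (Num.bound `|M|); rewrite (le_trans (ler_norm M))//.
rewrite (le_trans (ltW (archi_boundP (normr_ge0 M))))//.
by rewrite -natrX ler_nat ltnW// ltn_expl.
Qed.

Lemma sum_half_lt (R : realType) (e : R) n :
  0 < e -> \sum_(i < n) e / 2 ^+ i.+2 < e.
Proof.
move=> e0; rewrite (_ : \sum_(i < n) _ = e / 2 - e / 2 ^+ n.+1).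
  rewrite ltrBlDr ltr_wpDr//; first by rewrite divr_ge0// ?ltW// exprn_gt0.
  by rewrite ltr_pdivrMr// ltr_pMr// ltr1n.
elim: n => [|n IH]; first by rewrite big_ord0 subrr.
rewrite big_ord_recr /= IH !exprS; field.
by rewrite expf_neq0.
Qed.

(** * Convergence in the scalar field and in initial topologies *)

Lemma initial_cvgP (S : choiceType) (T : topologicalType) (f : S -> T)
    (F : set_system S) (s : S) : Filter F ->
  F --> (s : initial_topology f) <-> f @ F --> f s.
Proof.
move=> FF; split=> Fs A.
  by move=> nA; apply: Fs; exact: (@initial_continuous _ _ f s A nA).
move=> [_ [[C oC <-] Cs] CA]; apply: filterS CA _.
by apply: Fs; exact: open_nbhs_nbhs.
Qed.

Section modulus_topology.
Context {R : realType} {K : scalarField R}.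
Implicit Types (z w : K) (e : R).

Lemma modulusN z : modulus (- z) = modulus z.
Proof. by apply: (@of_real_inj _ K); rewrite !of_real_modulus normrN. Qed.

Lemma modulusB z w : modulus (z - w) = modulus (w - z).
Proof. by rewrite -modulusN opprB. Qed.

Lemma modulus_of_real (r : R) : 0 <= r -> modulus (of_real K r) = r.
Proof.
move=> r0; apply: (@of_real_inj _ K); rewrite of_real_modulus ger0_norm//.
by rewrite -(rmorph0 (of_real K)) ler_of_real.
Qed.

Lemma ltr_of_real : {mono of_real K : x y / x < y}.
Proof. exact/leW_mono/ler_of_real. Qed.

(** The positive elements of [K] are the images of the positive reals, since
    such an element equals its own norm; so real radii suffice. *)
Lemma cvg_modulusP (I : Type) (F : set_system I) (g : I -> K) (l : K) :
  Filter F ->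
  g @ F --> l <-> forall e, 0 < e -> \forall i \near F, modulus (l - g i) < e.
Proof.
move=> FF; split=> [gl e e0|gl].
  move/cvgrPdist_lt: gl => /(_ (of_real K e)).
  rewrite -{1}(rmorph0 (of_real K)) ltr_of_real => /(_ e0).
  by apply: filterS => i; rewrite -of_real_modulus ltr_of_real.
apply/cvgrPdist_lt => e e0; have eE : e = of_real K (modulus e).
  by rewrite of_real_modulus gtr0_norm.
move: e0; rewrite eE -{1}(rmorph0 (of_real K)) ltr_of_real => /gl.
by apply: filterS => i; rewrite -of_real_modulus ltr_of_real.
Qed.

Lemma modulus_continuous : continuous (@modulus R K).
Proof.
move=> z; have Fz := nbhs_filter z; apply/cvgrPdist_lt => e e0.
have := (@cvg_modulusP K (nbhs z) id z (nbhs_filter z)).1 cvg_id _ e0.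
apply: filterS => w /=; apply: le_lt_trans; rewrite ler_norml.
have := modulusD (z - w) w; have := modulusD (w - z) z.
by rewrite !subrK modulusB; lra.
Qed.

Lemma closed_modulus_le (r : R) : closed [set z : K | modulus z <= r].
Proof.
apply: (@closed_comp _ _ (@modulus R K) [set t | t <= r]); last exact: closed_le.
by move=> z _; exact: modulus_continuous.
Qed.

End modulus_topology.

(** * Topologies that agree on bounded sets *)

Section agreement.
Context {R : realType} {K : scalarField R} {E : normedModType K}.
Implicit Types (S T W : Topological E) (B : set E).

Definition nbhs_of T (f : E) : set_system E := @nbhs _ (Topological.Pack T) f.

Definition finer_on S T B :=
  forall f, B f -> within B (nbhs_of S f) `=>` nbhs_of T f.

(** Turns the comparison of traces of open sets into one of filters, where
    convergence criteria apply. If each point of [C `&` B], [C] being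
    [T]-open, is [S]-interior to [~` B `|` C], then that [S]-interior is an open
    set with the same trace as [C]. *)
Lemma finer_onP S T B : finer_on S T B <->
  [set A `&` B | A in open_of T] `<=` [set A `&` B | A in open_of S].
Proof.
split=> [ST A [C oC <-]|TS f Bf A].
- exists (@interior (Topological.Pack S) (fun g => B g -> C g)).
    exact: (@open_interior (Topological.Pack S)).
  apply/seteqP; split=> g [Cg Bg]; split => //.
    by apply: (@interior_subset (Topological.Pack S) _ _ Cg).
  apply: (ST g Bg).
  by apply: (@open_nbhs_nbhs (Topological.Pack T)); split.
- rewrite {1}/nbhs_of (@nbhsE (Topological.Pack T)) => -[C [oC Cf] CA].
  have [|D oD /seteqP[DC CD]] := TS (C `&` B); first by exists C.
  have [Df _] : (D `&` B) f by exact: CD.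
  have : @nbhs _ (Topological.Pack S) f D.
    by apply: (@open_nbhs_nbhs (Topological.Pack S)); split.
  apply: (@filterS _ (@nbhs _ (Topological.Pack S) f)) => g Dg Bg; apply: CA.
  by have [] : (C `&` B) g by exact: DC.
Qed.

Lemma agree_on_boundedP S T : agree_on_bounded S T <->
  forall B, bounded_set B -> finer_on S T B /\ finer_on T S B.
Proof.
split=> ST B /ST; first by move=> e; split; apply/finer_onP; rewrite e.
by move=> [/finer_onP TS /finer_onP ?]; apply/seteqP.
Qed.

Lemma agree_on_bounded_trans S T W :
  agree_on_bounded S T -> agree_on_bounded T W -> agree_on_bounded S W.
Proof. by move=> ST TW B bB; rewrite ST// TW. Qed.

End agreement.

(** * The norm of Lipschitz functions *)

Section lip_norm.
Context {R : realType} {K : scalarField R} {X : metricType R} {x0 : X}.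
Local Notation E := (lip0 K x0).
Implicit Types f g : E.

Lemma norm_lip0_le f (r : R) : (`|f| <= of_real K r) = (Lip f <= r).
Proof. exact: ler_of_real. Qed.

Lemma LipN f : Lip (- f) = Lip f.
Proof. by apply: (@of_real_inj _ K); exact: (normrN f). Qed.

Lemma LipB f g : Lip (f - g) <= Lip f + Lip g.
Proof. by rewrite (le_trans (LipD _ _))// LipN. Qed.

Lemma bounded_setP (B : set E) : bounded_set B <->
  exists2 M : R, 0 < M & forall f, B f -> Lip f <= M.
Proof.
split=> [|[M M0 BM]].
  move=> /ex_strict_bound_gt0 [M M0 BM].
  have ME : M = of_real K (modulus M) by rewrite of_real_modulus gtr0_norm.
  exists (modulus M) => [|f /BM/ltW]; last by rewrite -norm_lip0_le -ME.
  by rewrite -(ltr_of_real (K := K)) -ME rmorph0.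
exists (of_real K M); split.
  by rewrite realE -(rmorph0 (of_real K)) ler_of_real ltW.
by move=> N MN f /BM fM; rewrite /= (le_trans _ (ltW MN))// norm_lip0_le.
Qed.

End lip_norm.

(** * Pointwise convergence *)

Section pointwise.
Context {R : realType} (K : scalarField R) (X : metricType R) (x0 : X).
Local Notation E := (lip0 K x0).

Definition ptwise : Type :=
  initial_topology (fun f : E => (f : X -> K) : {ptws X -> K}).
HB.instance Definition _ := Topological.on ptwise.

Definition ptwise_topology : Topological E := Topological.class ptwise.

Lemma ptwise_cvgP (F : set_system E) (f : E) : Filter F ->
  F --> (f : ptwise) <-> forall x, (fun h : E => h x : K) @ F --> (f x : K).
Proof.
move=> FF; rewrite initial_cvgP cvg_sup; split => Ff x.
  by have /initial_cvgP := Ff x.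
by apply/initial_cvgP; exact: Ff.
Qed.

Lemma ptwise_eval_cvg (f : ptwise) x :
  (fun h : E => h x : K) @ nbhs f --> ((f : E) x : K).
Proof.
have Ff : nbhs f --> f by exact: cvg_id.
exact: ((ptwise_cvgP f (nbhs_filter f)).1 Ff x).
Qed.

Lemma ptwise_near (f : E) x (e : R) : 0 < e ->
  \forall g \near (f : ptwise), modulus (f x - (g : E) x) < e.
Proof.
have Ff := nbhs_filter (f : ptwise).
by move=> e0; exact: ((cvg_modulusP _ _ _).1 (@ptwise_eval_cvg f x)).
Qed.

Lemma ptwise_add_continuous :
  continuous (fun p : ptwise * ptwise => (p.1 : E) + (p.2 : E) : ptwise).
Proof.
move=> [f g]; apply/ptwise_cvgP => x /=.
have cf : (fun p : ptwise * ptwise => ((p.1 : E) x : K)) @ nbhs (f, g) -->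
    ((f : E) x : K).
  exact: (cvg_comp _ _ cvg_fst (@ptwise_eval_cvg f x)).
have cg : (fun p : ptwise * ptwise => ((p.2 : E) x : K)) @ nbhs (f, g) -->
    ((g : E) x : K).
  exact: (cvg_comp _ _ cvg_snd (@ptwise_eval_cvg g x)).
exact: (cvgD cf cg).
Qed.

Lemma ptwise_translate (f c : E) (A : set E) : nbhs (f + c : ptwise) A ->
  nbhs (f : ptwise) [set g : E | A (g + c)].
Proof.
have Ff := nbhs_filter (f : ptwise).
suff cfc : (fun g : E => g + c) @ nbhs (f : ptwise) --> (f + c : ptwise).
  by move=> /cfc.
apply/ptwise_cvgP => x.
have fx := @ptwise_eval_cvg f x.
have cx : (fun=> c x : K) @ nbhs (f : ptwise) --> (c x : K) by exact: cvg_cst.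
exact: (cvgD fx cx).
Qed.

(** The slabs form a base of neighborhoods of zero that are convex, balanced
    and, the inequality being large, closed. *)
Definition slab (s : seq X) (e : R) : set E :=
  [set h | forall x, x \in s -> modulus (h x : K) <= e].

Lemma nbhs0_slab (A : set E) : nbhs (0 : ptwise) A ->
  exists s, exists2 e : R, 0 < e & slab s e `<=` A.
Proof.
pose F := filter_from [set p : seq X * R | 0 < p.2] (fun p => slab p.1 p.2).
have FF : Filter F.
  apply: filter_from_filter; first by exists ([::], 1) => /=.
  move=> [s e] [t d] /= e0 d0; exists (s ++ t, Num.min e d).
    by rewrite /= lt_min e0 d0.
  move=> h /= sth; split=> x xs; have := sth x.
    by rewrite mem_cat xs le_min => /(_ isT)/andP[].
  by rewrite mem_cat xs orbT le_min => /(_ isT)/andP[].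
have F0 : F --> (0 : ptwise).
  apply/ptwise_cvgP => x; apply/cvg_modulusP => e e0.
  exists ([:: x], e / 2); first by rewrite /= divr_gt0.
  move=> h /(_ x); rewrite /= mem_head => /(_ isT) hx.
  by rewrite modulusB subr0 (le_lt_trans hx)// ltr_pdivrMr// ltr_pMr// ltr1n.
by move=> /F0 [[s e] /= e0 sA]; exists s, e.
Qed.

Lemma slab_nbhs s (e : R) : 0 < e -> nbhs (0 : ptwise) (slab s e).
Proof.
move=> e0; elim: s => [|x s IH]; first by apply: filterE => h x.
have := ptwise_near (0 : E) x e0.
apply: filterS2 IH => h hs; rewrite sub0r modulusN => hx y.
by rewrite inE => /predU1P[->|/hs//]; exact: ltW.
Qed.

Lemma closed_slab s (e : R) : closed (slab s e : set ptwise).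
Proof.
rewrite (_ : slab s e =
    \bigcap_(x in [set` s]) [set h : E | modulus (h x : K) <= e])//.
apply: closed_bigI => x _.
apply: (@closed_comp ptwise _ (fun h : E => h x : K)
    [set z : K | modulus z <= e]).
  by move=> h _; exact: ptwise_eval_cvg.
exact: closed_modulus_le.
Qed.

End pointwise.

(** * The weak* topology on bounded sets *)

Section weak_star.
Context {R : realType} (K : scalarField R) (X : metricType R) (x0 : X).
Local Notation E := (lip0 K x0).
Local Notation ptwise := (ptwise K x0).

Lemma weak_star_cvgP (F : set_system E) (f : E) : Filter F ->
  F `=>` nbhs_of (weak_star K x0) f <->
  forall phi : E -> K, lipschitz_free phi -> phi @ F --> phi f.
Proof.
move=> FF; rewrite /nbhs_of /weak_star /initial_topology_of.
set Tc := (fun phi : {phi | _ phi} => _); have := @cvg_sup _ _ Tc F f FF.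
move=> fE; split=> [/fE Ff phi lphi|Ff].
  by have /initial_cvgP := Ff (exist _ phi lphi).
by apply/fE => -[phi lphi]; apply/initial_cvgP; exact: Ff.
Qed.

Definition bounded_functional (phi : E -> K^o) :=
  linear phi /\ exists C : R, forall f, modulus (phi f : K) <= C * Lip f.

Lemma dual_space_bounded (phi : E -> K^o) :
  dual_space phi -> bounded_functional phi.
Proof.
move=> [lphi cphi]; split => //.
pose phiL : {linear E -> K^o} :=
  HB.pack phi (GRing.isLinear.Build _ _ _ _ phi lphi).
have phi0 : phi 0 = 0 by exact: (raddf0 phiL).
have phiZ a f : phi (a *: f) = a * phi f by exact: (linearZZ phiL).
have /cvg_modulusP/(_ _ ltr01) : phi @ nbhs (0 : E) --> (phi 0 : K).
  exact: cphi.
rewrite phi0 => /nbhs_norm0P[d /= d0 dphi].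
have dE : d = of_real K (modulus d) by rewrite of_real_modulus gtr0_norm.
have md0 : 0 < modulus d.
  by rewrite -(ltr_of_real (K := K)) -dE rmorph0.
exists (2 / modulus d) => f.
have [f0|f0] := eqVneq (Lip f) 0.
  by rewrite (Lip_eq0 f0) phi0 modulus0 mulr_ge0 ?Lip_ge0// divr_ge0// ltW.
have Lf0 : 0 < Lip f by rewrite lt_neqAle eq_sym f0 Lip_ge0.
(* [r] scales [f] to norm [d / 2], where [phi] is bounded by 1. *)
pose r := modulus d / 2 / Lip f.
have r0 : 0 < r by rewrite !divr_gt0.
have /dphi/= : `|of_real K r *: f| < d.
  rewrite dE -[X in X < _]/(of_real K (Lip (of_real K r *: f))) ltr_of_real LipZ.
  rewrite modulus_of_real ?(ltW r0)// /r divfK//.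
  by rewrite ltr_pdivrMr// ltr_pMr// ltr1n.
rewrite sub0r modulusN phiZ modulusM modulus_of_real ?(ltW r0)//.
rewrite mulrC -ltr_pdivlMr// mul1r => /ltW/le_trans; apply.
by rewrite /r !invf_div mulrC.
Qed.

(** Boundedness makes the supremum in [dual_norm] a genuine one; the set of
    values has no upper bound otherwise, and the supremum a default value. *)
Lemma le_dual_norm (phi : E -> K^o) f : bounded_functional phi ->
  modulus (phi f : K) <= dual_norm phi * Lip f.
Proof.
move=> [lphi [C phiC]].
pose phiL : {linear E -> K^o} :=
  HB.pack phi (GRing.isLinear.Build _ _ _ _ phi lphi).
have phi0 : phi 0 = 0 by exact: (raddf0 phiL).
have phiZ a g : phi (a *: g) = a * phi g by exact: (linearZZ phiL).
have [f0|f0] := eqVneq (Lip f) 0.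
  by rewrite f0 mulr0 (Lip_eq0 f0) phi0 modulus0.
have Lf0 : 0 < Lip f by rewrite lt_neqAle eq_sym f0 Lip_ge0.
rewrite -ler_pdivrMr//; apply: ub_le_sup.
  exists `|C| => _ [g /= g1 <-].
  have Lg1 : Lip g <= 1 by rewrite -(norm_lip0_le (K := K)) rmorph1.
  rewrite (le_trans (phiC g))// (le_trans (ler_norm _))// normrM.
  by rewrite ler_piMr// ger0_norm ?Lip_ge0.
exists (of_real K (Lip f)^-1 *: f) => /=.
  rewrite -(rmorph1 (of_real K)) norm_lip0_le LipZ modulus_of_real.
    by rewrite mulVf.
  by rewrite invr_ge0 Lip_ge0.
by rewrite phiZ modulusM modulus_of_real ?invr_ge0 ?Lip_ge0// mulrC.
Qed.

Lemma modulus_delta_le (f : E) x : modulus (delta x f : K) <= mdist x x0 * Lip f.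
Proof. by have := le_Lip f x x0; rewrite lip0_base subr0 mulrC. Qed.

Definition ptwise_continuous (phi : E -> K^o) :=
  forall f : E, (phi : E -> K) @ nbhs (f : ptwise) --> (phi f : K).

Lemma linear_hull_delta (psi : E -> K^o) :
  linear_hull (range (@delta R K X x0)) psi ->
  bounded_functional psi /\ ptwise_continuous psi.
Proof.
move=> [n [a [g [gd ->]]]].
apply: (big_ind (fun psi => bounded_functional psi /\ ptwise_continuous psi)).
- split; last by move=> f; exact: cvg_cst.
  split; first by move=> b f h; rewrite scaler0 addr0.
  by exists 0 => f; rewrite mul0r modulus0.
- move=> p q [[lp [C pC]] cp] [[lq [D qD]] cq]; split.
    split=> [b f h|]; first by rewrite !fctE lp lq scalerDr addrACA.
    exists (C + D) => f; rewrite mulrDl (le_trans (modulusD _ _))// lerD//.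
  by move=> f; apply: cvgD; [exact: cp|exact: cq].
- move=> i _; have [x _ <-] := gd i; split.
    split=> [b f h|]; first by rewrite !fctE /delta /= !scalerDr !scalerA mulrC.
    exists (modulus (a i) * mdist x x0) => f.
    by rewrite -mulrA modulusM ler_wpM2l ?modulus_ge0// modulus_delta_le.
  by move=> f; apply: cvgZr; exact: (@ptwise_eval_cvg R K X x0 f x).
Qed.

Lemma delta_dual_space x : dual_space (@delta R K X x0 x).
Proof.
split=> // f; have Ff := nbhs_filter f; apply/cvg_modulusP => e e0.
(* Adding 1 keeps the divisor nonzero when [x] is the base point. *)
have d0 : 0 < e / (mdist x x0 + 1) by rewrite divr_gt0// ltr_wpDl ?mdist_ge0.
have : \forall g \near f, `|f - g| < of_real K (e / (mdist x x0 + 1)).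
  apply: (@cvgr_dist_lt _ _ _ (nbhs f) _ id f); first exact: cvg_id.
  by rewrite -(rmorph0 (of_real K)) ltr_of_real.
apply: filterS => g.
rewrite -[X in X < _ -> _]/(of_real K (Lip (f - g))) ltr_of_real => fg.
have := modulus_delta_le (f - g) x; rewrite /delta /= => /le_lt_trans; apply.
rewrite (@le_lt_trans _ _ ((mdist x x0 + 1) * Lip (f - g)))//.
  by rewrite ler_wpM2r ?Lip_ge0// lerDl.
by rewrite -ltr_pdivlMl 1?mulrC// ltr_wpDl ?mdist_ge0.
Qed.

Lemma delta_lipschitz_free x : lipschitz_free (@delta R K X x0 x).
Proof.
split; first exact: delta_dual_space.
move=> e e0; exists (delta x).
  exists 1%N, (fun=> 1), (fun=> delta x); split; first by move=> _; exists x.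
  by rewrite big_ord1 scale1r.
rewrite subrr /dual_norm (_ : [set _ | _ in _] = [set 0]) ?sup1//.
apply/seteqP; split=> [_ [f _ <-]|_ ->] /=; first by rewrite modulus0.
by exists 0; rewrite /= ?normr0 ?ler01// modulus0.
Qed.

(** Pointwise convergence is weak* convergence against the evaluations and
    their linear combinations [psi]. An element [phi] of the free space is
    within [e / (4 M)] of some [psi], so the two differ by at most [e / 2] on
    differences of functions of norm at most [M]. *)
Lemma ptwise_agree_weak_star :
  agree_on_bounded (ptwise_topology K x0) (weak_star K x0).
Proof.
apply/agree_on_boundedP => B /bounded_setP[M M0 BM]; split=> f Bf.
  have FF : Filter (within B (nbhs (f : ptwise))) by exact: within_filter.
  apply/weak_star_cvgP => phi [dphi phin]; apply/cvg_modulusP => e e0.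
  have [|psi hpsi npsi] := phin (e / (4 * M)).
    by rewrite divr_gt0// mulr_gt0.
  have [bpsi cpsi] := linear_hull_delta hpsi.
  have bB : bounded_functional (phi - psi).
    have [lphi [C phiC]] := dual_space_bounded dphi.
    have [lpsi [D psiD]] := bpsi; split=> [b g h|].
      by rewrite !fctE lphi lpsi scalerBr opprD addrACA.
    exists (C + D) => g; rewrite mulrDl (le_trans (modulusD _ _))// lerD//.
    by rewrite modulusN.
  have : \forall g \near (f : ptwise), modulus (psi f - psi g : K) < e / 2.
    have Ff := nbhs_filter (f : ptwise).
    by apply: (cvg_modulusP _ _ _).1 (cpsi f) _ _; rewrite divr_gt0.
  apply: filterS => g fg Bg.
  have bg := le_dual_norm (f - g) bB.
  have [lB _] := bB.
  pose dL : {linear E -> K^o} :=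
    HB.pack (phi - psi) (GRing.isLinear.Build _ _ _ _ (phi - psi) lB).
  have dB : (phi - psi) (f - g) = (phi f - psi f) - (phi g - psi g).
    exact: (raddfB dL).
  rewrite dB in bg.
  have -> : phi f - phi g =
      ((phi f - psi f) - (phi g - psi g)) + (psi f - psi g) :> K by ring.
  rewrite (le_lt_trans (modulusD _ _))// [e]splitr ler_ltD//.
  apply: (le_trans bg).
  have fgM : Lip (f - g) <= 2 * M.
    by rewrite (le_trans (LipB _ _))// mulr_natl mulr2n lerD// BM.
  have -> : e / 2 = e / (4 * M) * (2 * M) by field; rewrite lt0r_neq0.
  rewrite (le_trans (ler_wpM2r (Lip_ge0 _) (ltW npsi)))//.
  by rewrite ler_wpM2l// divr_ge0// ?ltW// mulr_gt0.
have Ff : Filter (nbhs_of (weak_star K x0) f).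
  exact: (@nbhs_filter (Topological.Pack (weak_star K x0))).
move=> A; rewrite /within.
suff Hf : nbhs_of (weak_star K x0) f `=>` nbhs (f : ptwise).
  by move=> /Hf; apply: filterS.
apply/ptwise_cvgP => x.
have : nbhs_of (weak_star K x0) f `=>` nbhs_of (weak_star K x0) f by [].
by move/weak_star_cvgP => /(_ _ (delta_lipschitz_free x)).
Qed.

End weak_star.

(** * The mixed topology on bounded sets *)

Section mixed.
Context {R : realType} (K : scalarField R) (X : metricType R) (x0 : X).
Local Notation E := (lip0 K x0).
Local Notation ptwise := (ptwise K x0).
Local Notation tau0 := (lip0_compact_open K x0).
Local Notation slab := (@slab R K X x0).

(** A ball is equicontinuous: near a point [x], a function of norm at most [M]
    is controlled by its value at [x]. Covering a compact set by such
    neighborhoods leaves finitely many values to control. *)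
Lemma compact_open_on_ball (M : R) (U : set E) : 0 < M ->
  nbhs (0 : tau0) U -> \forall h \near (0 : ptwise), Lip (h : E) <= M -> U h.
Proof.
move=> M0 U0; pose F := within [set h : E | Lip h <= M] (nbhs (0 : ptwise)).
have FF : Filter F by exact: within_filter.
suff : F --> (0 : tau0) by move/(_ _ U0).
apply/initial_cvgP/compact_open_cvgP => C W cC oW CW.
suff : \forall h \near (0 : ptwise), C `<=`
    (fun x => Lip (h : E) <= M -> W ((h : E) x : K)).
  apply: filterS => h hC hM _ [x Cx <-]; exact: hC.
move/compact_near_coveringP : cC => /(_ _ (nbhs (0 : ptwise))
  (fun (h : E) y => Lip h <= M -> W (h y : K)) (nbhs_filter (0 : ptwise))).
apply => x Cx.
have /nbhs_ballP[e /= e0 eW] : nbhs (0 : K) W.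
  apply: open_nbhs_nbhs; split=> //.
  by apply: CW; exists x.
have eE : e = of_real K (modulus e) by rewrite of_real_modulus gtr0_norm.
have me0 : 0 < modulus e by rewrite -(ltr_of_real (K := K)) -eE rmorph0.
have d0 : 0 < modulus e / 2 / M by rewrite !divr_gt0.
near=> y h => hM; apply: eW.
rewrite -ball_normE /= sub0r normrN eE -of_real_modulus.
rewrite ltr_of_real [ltRHS]splitr.
have -> : (h : E) y = ((h : E) y - (h : E) x) + (h : E) x :> K by rewrite subrK.
rewrite (le_lt_trans (modulusD _ _))// ler_ltD//.
  rewrite (le_trans (le_Lip _ _ _))// (le_trans (ler_wpM2r (mdist_ge0 _ _) hM))//.
  rewrite -ler_pdivlMl// mulrC metric_sym; apply/ltW.
  suff : ball x (modulus e / 2 / M) y by rewrite ballEmdist.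
  by near: y; exact: nbhsx_ballx.
near: h; have e20 : 0 < modulus e / 2 by rewrite divr_gt0.
have := ptwise_near (0 : E) x e20.
by apply: filterS => h; rewrite sub0r modulusN.
Unshelve. all: by end_near. Qed.

Lemma compact_open_ptwise : nbhs (0 : tau0) `=>` nbhs (0 : ptwise).
Proof.
have F0 := nbhs_filter (0 : tau0).
apply/ptwise_cvgP => x U.
rewrite nbhsE => -[W [oW W0] WU].
have /initial_cvgP/compact_open_cvgP : nbhs (0 : tau0) --> (0 : tau0).
  exact: cvg_id.
move=> /(_ [set x] W (@compact_set1 _ x) oW); rewrite image_set1 => H.
have {H}/H : [set (0 : E) x : K] `<=` W by move=> _ ->.
apply: (@filterS _ _ F0) => h /=; rewrite image_set1 => hW.
by apply: WU; exact: hW.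
Qed.

Lemma slab_index (s : nat -> seq X) (e : nat -> R) : (forall n, 0 < e n) ->
  mixed_index (fun n => slab (s n) (e n)).
Proof.
move=> e0 n; split; last by apply: compact_open_ptwise; exact: slab_nbhs.
- move=> f g l /set_mem fs /set_mem gs; apply/mem_set => x xs.
  have [t [tE t0 t1]] : exists t : K, [/\ l%:num = t, 0 <= t & t <= 1].
    by exists l%:num.
  rewrite -[X in modulus X]/(l%:num * (f x : K) + (1 - l%:num) * (g x : K)) tE.
  rewrite (le_trans (modulusD _ _))// !modulusM.
  have mtE : modulus (1 - t) = 1 - modulus t.
    apply: (@of_real_inj _ K).
    by rewrite rmorphB rmorph1 !of_real_modulus !ger0_norm ?subr_ge0.
  have mt1 : 0 <= 1 - modulus t by rewrite -mtE modulus_ge0.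
  rewrite mtE [leRHS](_ : _ = modulus t * e n + (1 - modulus t) * e n).
    by rewrite lerD// ler_wpM2l// ?modulus_ge0// ?fs ?gs.
  by rewrite -mulrDl addrC subrK mul1r.
- move=> a f a1 fs x xs; rewrite -[X in modulus X]/(a * (f x : K)) modulusM.
  rewrite -(rmorph1 (of_real K)) -of_real_modulus ler_of_real in a1.
  rewrite (le_trans (ler_wpM2r (modulus_ge0 _) a1))// mul1r.
  exact: fs.
Qed.

(** With slabs of widths [e / 4], [e / 8], ... at [x], an element of the mixed
    set has modulus less than [e] at [x], whatever its number of summands. *)
Lemma mixed_ptwise (f : E) : nbhs (f : lip0_mixed K x0) `=>` nbhs (f : ptwise).
Proof.
have Ff := nbhs_filter (f : lip0_mixed K x0).
apply/ptwise_cvgP => x; apply/cvg_modulusP => e e0.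
exists (fun n => slab [:: x] (e / 2 ^+ n.+2)).
  by apply: slab_index => n; rewrite divr_gt0// exprn_gt0.
move=> _ [_ [n [h [hs ->]]] <-] /=.
rewrite -[X in modulus X]/((f x : K) -
  ((f x : K) + (\sum_(i < n.+1) h i : E) x)).
rewrite opprD addNKr modulusN (le_lt_trans _ (sum_half_lt n.+1 e0))//.
elim/big_rec2 : _ => [|i y g _ IH]; first by rewrite modulus0.
rewrite (le_trans (modulusD _ _))// lerD//.
have [|+ _] := hs i; first by rewrite -ltnS.
by apply; rewrite mem_head.
Qed.

Lemma ptwise_agree_mixed :
  agree_on_bounded (mixed_topology K x0) (ptwise_topology K x0).
Proof.
apply/agree_on_boundedP => B /bounded_setP[M M0 BM]; split=> f Bf.
  move=> A /(@mixed_ptwise f) fA; rewrite /within.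
  by apply: (@filterS _ _ (nbhs_filter (f : lip0_mixed K x0))) fA.
move=> A [U mU UA].
(* For [2 ^ n >= 2 M], the [n]-th summand alone reaches every [g - f]. *)
have [n Mn] := le_exp2_ex (2 * M).
have [_ _ nU] := mU n.
have M20 : 0 < 2 * M by rewrite mulr_gt0.
have := compact_open_on_ball M20 nU.
rewrite -{1}(subrr f) => /ptwise_translate; rewrite /within /nbhs_of /=.
apply: (@filterS _ _ (nbhs_filter (f : ptwise))) => g gU Bg; apply: UA.
have gfM : Lip (g - f) <= 2 * M.
  by rewrite (le_trans (LipB _ _))// mulr_natl mulr2n lerD// BM.
exists (g - f); last by rewrite addrC subrK.
exists n, (fun i => if i == n then g - f else 0); split=> [i _|].
  case: eqP => [->|_]; last first.
    by split; [exact: mixed_index0|rewrite normr0 exprn_ge0].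
  split; first exact: gU.
  rewrite (_ : 2 ^+ n = of_real K (2 ^+ n)); last by rewrite rmorphXn rmorph_nat.
  by rewrite norm_lip0_le (le_trans gfM).
rewrite big_ord_recr /= eqxx big1 ?add0r// => i _.
by rewrite ltn_eqF.
Qed.

End mixed.

(** * Maximality of the mixed topology *)

Definition heine_borel {R : realType} (K : scalarField R) :=
  forall r : R, compact [set z : K | modulus z <= r].

Section maximality.
Context {R : realType} (K : scalarField R) (X : metricType R) (x0 : X).
Local Notation E := (lip0 K x0).
Local Notation ptwise := (ptwise K x0).
Local Notation slab := (@slab R K X x0).

(** Alaoglu for balls of Lipschitz functions: inside the product of all
    functions, the ball is the closed subset [Q] of a product of discs [P]. *)
Lemma ball_compact (M : R) : heine_borel K -> 0 <= M ->
  compact ([set h : E | Lip h <= M] : set ptwise).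
Proof.
move=> hb M0.
pose P := [set g : {ptws X -> K} | forall x, modulus (g x) <= M * mdist x x0].
have cP : compact P.
  exact: (@tychonoff X (fun=> K)
    (fun x => [set z : K | modulus z <= M * mdist x x0])).
have ev x : continuous ((fun g => g x) : {ptws X -> K} -> K).
  move=> g; have : nbhs g --> g by exact: cvg_id.
  by move/cvg_sup => /(_ x)/initial_cvgP.
pose Q := [set g : {ptws X -> K} | g x0 = 0 /\
  forall x y, modulus (g x - g y) <= M * mdist x y].
have cQ : compact Q.
  have -> : Q = P `&` ([set g : {ptws X -> K} | modulus (g x0) <= 0] `&`
      \bigcap_p [set g : {ptws X -> K} |
        modulus (g p.1 - g p.2) <= M * mdist p.1 p.2]).
    apply/seteqP; split=> [g [g0 gM]|g [_ [g0 gM]]].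
      split; first by move=> x; have := gM x x0; rewrite g0 subr0.
      split; first by rewrite /= g0 modulus0.
      by move=> [x y] _; exact: gM.
    split; last by move=> x y; exact: (gM (x, y)).
    by apply/modulus_eq0/eqP; rewrite eq_le g0 modulus_ge0.
  apply: compact_closedI => //; apply: closedI.
    apply: (@closed_comp _ _ (fun g : {ptws X -> K} => g x0)
        [set z : K | modulus z <= 0]).
      by move=> g _; exact: ev.
    exact: closed_modulus_le.
  apply: closed_bigI => -[x y] _ /=.
  apply: (@closed_comp _ _ (fun g : {ptws X -> K} => g x - g y)
     [set z : K | modulus z <= M * mdist x y]); last exact: closed_modulus_le.
  by move=> g _; exact: (cvgB (ev x g) (ev y g)).
(* A cluster point in [Q] of the image filter is itself an element of the ball,
   hence a cluster point for the initial topology. *)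
move=> F PF FM; pose i (h : E) : {ptws X -> K} := (h : X -> K).
have FQ : (i @ F) Q.
  apply: (@filterS _ F _ _ _ _ FM) => h /= hM; split; first exact: (lip0_base h).
  by move=> x y; rewrite (le_trans (le_Lip h x y))// ler_wpM2r ?mdist_ge0.
have [g [[g0 gM] Fg]] := cQ _ (fmap_proper_filter i PF) FQ.
have gP : (g : X -> K^o) \in @lip0_pred R K X x0.
  by apply/asboolP; split => //; exists M.
exists (Lip0 gP); split; first exact: Lip_le.
move=> A B FA [_ [[C oC <-] Cg] CB].
have [_ [[h Ah <-] Ch]] : (i @` A) `&` C !=set0.
  apply: Fg; last exact: open_nbhs_nbhs.
  by apply: (@filterS _ F _ _ _ _ FA) => h Ah; exists h.
by exists h; split=> //; exact: CB.
Qed.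

Definition ptwise_open_on_balls (V : set E) := forall M h, V h -> Lip h <= M ->
  \forall g \near (h : ptwise), Lip (g : E) <= M -> V g.

(** A tube lemma: continuity of addition gives, for each [c], a neighborhood of
    [(c, 0)] that works, and compactness of [C] makes the second factor
    uniform. *)
Lemma compact_step (V C : set E) (M : R) : ptwise_open_on_balls V ->
  compact (C : set ptwise) -> C `<=` V -> (forall c, C c -> Lip c <= M) ->
  \forall k \near (0 : ptwise),
    forall c, C c -> Lip (c + (k : E)) <= M -> V (c + (k : E)).
Proof.
move=> oV /compact_near_coveringP/(_ _ (nbhs (0 : ptwise))
  (fun (k : E) c => Lip (c + k) <= M -> V (c + k))
  (nbhs_filter (0 : ptwise))) cC CV CM.
apply: cC => c Cc.
have := oV M _ (CV _ Cc) (CM _ Cc); rewrite -{1}(addr0 c).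
by move/(@ptwise_add_continuous R K X x0 (c, 0)).
Qed.

Definition sum_set (A B : set E) : set E := [set p.1 + p.2 | p in A `*` B].

Lemma compact_sum_set (A B : set ptwise) :
  compact A -> compact B -> compact (sum_set A B : set ptwise).
Proof.
move=> cA cB.
apply: (@continuous_compact _ _
    (fun p : ptwise * ptwise => (p.1 : E) + (p.2 : E) : ptwise)).
  by apply: continuous_subspaceT; exact: ptwise_add_continuous.
exact: compact_setX.
Qed.

(** The Banach-Dieudonne construction: [S n] is the sum of the sets
    [U i `&` ball i] for [i < n], and [U n] is a slab, chosen from [S n], such
    that [S n.+1] remains inside [V]. Slabs being closed, [S n.+1] is again
    compact. *)
Lemma mixed_set_sub (V : set E) :
  heine_borel K -> ptwise_open_on_balls V -> V 0 ->
  exists2 U : nat -> set E, mixed_index U & mixed_set U `<=` V.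
Proof.
move=> hb oV V0.
pose ball n := [set h : E | Lip h <= 2 ^+ n].
pose inv n S := [/\ compact (S : set ptwise), S `<=` V & S `<=` ball n].
pose good n S (p : seq X * R) := 0 < p.2 /\
  sum_set S (slab p.1 p.2 `&` ball n) `<=` V.
have step n S : exists p, 0 < p.2 /\ (inv n S -> good n S p).
  have [[cS SV Sn]|ninv] := pselect (inv n S); last by exists ([::], 1).
  have Sn1 c : S c -> Lip c <= 2 ^+ n.+1.
    move=> /Sn cn; rewrite (le_trans cn)// ler_eXn2l//; lra.
  have [s [e e0 sV]] := nbhs0_slab (compact_step oV cS SV Sn1).
  exists (s, e); split => // _; split => //= _ [[c k] /= [Sc [ks kn]] <-].
  apply: (sV k ks c Sc); rewrite (le_trans (LipD _ _))// exprS mulr_natl mulr2n.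
  by rewrite lerD//; exact: Sn.
have [p pP] := choice (fun nS : nat * set E => step nS.1 nS.2).
pose W n S := slab (p (n, S)).1 (p (n, S)).2.
pose S := fix S n :=
  if n is m.+1 then sum_set (S m) (W m (S m) `&` ball m) else [set (0 : E)].
have invS n : inv n (S n).
  elim: n => [|n IH].
    split; first exact: compact_set1.
      by move=> _ ->.
    move=> _ ->; rewrite /ball /= expr0.
    by rewrite -(norm_lip0_le (K := K)) normr0 rmorph1.
  have [_ /(_ IH)[_ SV]] := pP (n, S n); have [cS _ Sn] := IH.
  split=> //=.
    apply: compact_sum_set => //; rewrite setIC; apply: compact_closedI.
      by apply: ball_compact => //; rewrite exprn_ge0.
    exact: closed_slab.
  move=> _ [[c k] /= [Sc [_ kn]] <-]; rewrite /ball /=.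
  rewrite (le_trans (LipD _ _))// exprS mulr_natl mulr2n lerD//; exact: Sn.
exists (fun n => W n (S n)).
  by apply: slab_index => n; have [] := pP (n, S n).
move=> _ [n [h [hW ->]]].
suff : S n.+1 (\sum_(i < n.+1) h i) by have [_ + _] := invS n.+1; apply.
have : forall m, (m <= n.+1)%N -> S m (\sum_(i < m) h i).
  elim=> [_|m IH mn]; first by rewrite big_ord0.
  exists (\sum_(i < m) h i, h m); last by rewrite big_ord_recr.
  split; first by apply: IH; exact: ltnW.
  have [Wh hm] := hW m mn; split => //=.
  rewrite /ball /= -(norm_lip0_le (K := K)).
  by rewrite (_ : of_real K (2 ^+ m) = 2 ^+ m)// rmorphXn rmorph_nat.
exact.
Qed.

(** Balls around an arbitrary point [f] of [V] are bounded sets too, so the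
    translate of [V] by [- f] is again relatively open on balls around 0. *)
Lemma open_mixed (S : Topological E) : heine_borel K ->
  agree_on_bounded S (ptwise_topology K x0) ->
  open_of S `<=` open_of (mixed_topology K x0).
Proof.
move=> hb /agree_on_boundedP SP V oV.
rewrite /open_of (@openE (Topological.Pack (mixed_topology K x0))) => f Vf.
pose V' := [set h | V (f + h)].
have oV' : ptwise_open_on_balls V'.
  move=> M h Vfh hM.
  pose B := [set g : E | Lip (g - f) <= M].
  have bB : bounded_set B.
    apply/bounded_setP; exists (`|M| + Lip f + 1).
      by rewrite ltr_wpDl// addr_ge0// Lip_ge0.
    move=> g /= gM; rewrite -(subrK f g) (le_trans (LipD _ _))//.
    by rewrite ler_wpDr// lerD// (le_trans gM)// ler_norm.
  have [_ PS] := SP _ bB.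
  have Bfh : B (f + h) by rewrite /B /= addrC addKr.
  have SV : nbhs_of S (f + h) V.
    by apply: (@open_nbhs_nbhs (Topological.Pack S)); split.
  have PV : nbhs (h + f : ptwise) [set g : E | B g -> V g].
    by rewrite addrC; exact: PS Bfh V SV.
  have hfV : nbhs (h : ptwise) [set g : E | B (g + f) -> V (g + f)].
    exact: ptwise_translate PV.
  have gV' (g : E) : (B (g + f) -> V (g + f)) -> Lip g <= M -> V' g.
    by move=> gV gM; rewrite /V' /= addrC; apply: gV; rewrite /B /= addrK.
  exact: (filterS gV' hfV).
have V'0 : V' 0 by rewrite /V' /= addr0.
have [U mU UV] := mixed_set_sub hb oV' V'0.
by exists U => // _ [g /UV ? <-].
Qed.

Lemma mixed_is_bounded_weak_star :
  heine_borel K -> is_bounded_weak_star (mixed_topology K x0).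
Proof.
move=> hb; split.
  exact: agree_on_bounded_trans (@ptwise_agree_mixed _ _ _ _)
    (@ptwise_agree_weak_star _ _ _ _).
move=> S Sw; apply: open_mixed => // B bB.
by rewrite Sw// -ptwise_agree_weak_star.
Qed.

End maximality.

(** * Real and complex scalars *)

Section scalars.
Context {R : realType}.

Lemma heine_borel_real : heine_borel (real_scalar R).
Proof.
move=> r.
rewrite (_ : [set _ | _] = `[- r, r]%classic); first exact: segment_compact.
by apply/seteqP; split=> z /=; rewrite in_itv /= -ler_norml.
Qed.

(** The disc is a closed subset of the continuous image of a square. *)
Lemma heine_borel_complex : heine_borel (complex_scalar R).
Proof.
move=> r.
pose f (p : R * R) : complex_scalar R := (p.1 +i* p.2)%C.
have fB p q : modulus (f p - f q) <= `|p.1 - q.1| + `|p.2 - q.2|.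
  rewrite -[X in X <= _]/(Num.sqrt ((p.1 - q.1) ^+ 2 + (p.2 - q.2) ^+ 2)).
  rewrite -ler_sqr ?nnegrE ?addr_ge0// sqr_sqrtr ?addr_ge0 ?sqr_ge0//.
  rewrite [leRHS]sqrrD !real_normK ?num_real// -addrA lerD2l lerDr.
  by rewrite mulrn_wge0// mulr_ge0.
have fc : continuous f.
  move=> p; have Fp := nbhs_filter p; apply/cvg_modulusP => e e0.
  have e20 : 0 < e / 2 by rewrite divr_gt0.
  have h1 : \forall q \near p, `|p.1 - q.1| < e / 2.
    have := @cvgr_dist_lt R R _ (nbhs p) _ fst p.1; apply => //.
    by case: (p) => p1 p2; exact: cvg_fst.
  have h2 : \forall q \near p, `|p.2 - q.2| < e / 2.
    have := @cvgr_dist_lt R R _ (nbhs p) _ snd p.2; apply => //.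
    by case: (p) => p1 p2; exact: cvg_snd.
  apply: filterS2 h1 h2 => q q1 q2.
  by rewrite (le_lt_trans (fB p q))// [e]splitr ltrD.
have cf : compact (f @` (`[- r, r]%classic `*` `[- r, r]%classic)).
  apply: continuous_compact; first exact: continuous_subspaceT.
  by apply: compact_setX; exact: segment_compact.
apply: (subclosed_compact _ cf); first exact: closed_modulus_le.
move=> [a b] /= abr; exists (a, b) => //=.
have [ar br] : `|a| <= r /\ `|b| <= r.
  have leS (u v : R) : `|u| <= Num.sqrt (u ^+ 2 + v ^+ 2).
    by rewrite -sqrtr_sqr ler_wsqrtr// lerDl sqr_ge0.
  split; apply: le_trans abr; first exact: leS.
  by rewrite /= addrC; exact: leS.
by split; rewrite /= in_itv /= -ler_norml.
Qed.

End scalars.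

Theorem corollary2p4 (R : realType) (X : metricType R) (x0 : X) :
  is_bounded_weak_star (mixed_topology (real_scalar R) x0) /\
  is_bounded_weak_star (mixed_topology (complex_scalar R) x0).
Proof.
split; apply: mixed_is_bounded_weak_star.
  exact: heine_borel_real.
exact: heine_borel_complex.
Qed.
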